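(* Let $\mathbb{F}_q$ be a finite field, let $0<i<n$ be integers and let $a,b\in\mathbb{F}_q\setminus\{0\}$. Let $g(x)\in\mathbb{F}_q[x]$ be a monic polynomial with $g(x)^2=x^n-ax^i-b$. Then the polycyclic code $C$ of length $n$ over $\mathbb{F}_q$ associated with $x^n-ax^i-b$ and generated by $g(x)$ is isodual.
   Context: Vectors $(c_0,\dots,c_{n-1})\in\mathbb{F}_q^n$ are identified with polynomials $c_0+c_1x+\cdots+c_{n-1}x^{n-1}$. For a monic polynomial $f(x)\in\mathbb{F}_q[x]$ of degree $n$ and a monic divisor $g(x)$ of $f(x)$, the polycyclic code associated with $f(x)$ and generated by $g(x)$ is the ideal $\langle g(x)\rangle$ of $\mathbb{F}_q[x]/\langle f(x)\rangle$, i.e. the set of all multiples of $g(x)$ of degree less than $n$, viewed as a linear code of length $n$. Two linear codes $C_1,C_2$ of length $n$ over $\mathbb{F}_q$ are equivalent if there is a monomial $n\times n$ matrix $M$ over $\mathbb{F}_q$ (exactly one non-zero entry in each row and each column) with $C_2=\{cM: c\in C_1\}$. The dual $C^\perp$ is taken with respect to the Euclidean inner product; $C$ is isodual if $C$ is equivalent to $C^\perp$. *)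

(* Defs.v *)
From HB Require Import structures.
From mathcomp Require Import all_boot all_order all_algebra.

Set Implicit Arguments.
Unset Strict Implicit.
Unset Printing Implicit Defensive.

Import GRing.Theory.
Local Open Scope ring_scope.

(* A vector c : 'rV[F]_n is identified with the polynomial rVpoly c, whose
   coefficient of 'X^j is c 0 j. *)

Section LinearCodes.

Variables (F : finFieldType) (n : nat).
Implicit Types (C : {set 'rV[F]_n}) (M : 'M[F]_n) (f g : {poly F}).

(* The ideal generated by the class of g in F[x]/<f>, pulled back along the
   identification of vectors with polynomials of degree < n. It is meant for f
   monic of degree n > 0: otherwise {poly %/ f} is not F[x]/<f> (see mk_monic)
   or vectors do not represent its elements uniquely. *)
Definition polycyclic_code f g : {set 'rV[F]_n} :=
  [set c | [exists h : {poly %/ f},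
              in_qpoly f (rVpoly c) == in_qpoly f g * h]].

Definition monomial_mx M : bool :=
  [forall i, #|[set j | M i j != 0]| == 1%N] &&
  [forall j, #|[set i | M i j != 0]| == 1%N].

Definition code_equiv C1 C2 : Prop :=
  exists2 M, monomial_mx M & C2 = [set c *m M | c in C1].

Definition dual_code C : {set 'rV[F]_n} :=
  [set v : 'rV[F]_n | [forall (c | c \in C), \sum_(j < n) c 0 j * v 0 j == 0]].

Definition isodual C : Prop := code_equiv C (dual_code C).

Lemma polycyclic_code_submod f g :
  submod_closed [in polycyclic_code f g].
Proof.
split=> [|k u v]; rewrite !inE.
  by apply/existsP; exists 0; rewrite linear0 in_qpoly0 mulr0.
move=> /existsP[h1 /eqP uE] /existsP[h2 /eqP vE].
apply/existsP; exists (k *: h1 + h2).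
by rewrite linearP /= in_qpolyD in_qpolyZ uE vE mulrDr scalerAr.
Qed.

Lemma dual_code_submod C : submod_closed [in dual_code C].
Proof.
split=> [|k u v]; rewrite !inE.
  by apply/forall_inP=> c _; rewrite big1 // => j _; rewrite mxE mulr0.
move=> /forall_inP uC /forall_inP vC; apply/forall_inP=> c cC; apply/eqP.
transitivity (k * (\sum_(j < n) c 0 j * u 0 j) + \sum_(j < n) c 0 j * v 0 j).
  rewrite big_distrr -big_split; apply: eq_bigr => j _ /=.
  by rewrite !mxE mulrDr mulrCA.
by rewrite (eqP (uC c cC)) (eqP (vC c cC)) mulr0 addr0.
Qed.

Lemma mem_polycyclic_code f g (c : 'rV[F]_n) :
    f \is monic -> size f = n.+1 -> (0 < n)%N -> g %| f ->
  (c \in polycyclic_code f g) = (g %| rVpoly c).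
Proof.
move=> fM szf n_gt0 gf.
have mkf : mk_monic f = f by rewrite /mk_monic fM szf ltnS n_gt0.
have rmodE p : Pdiv.CommonRing.rmodp p (mk_monic f) = p %% f.
  by rewrite mkf -(@Pdiv.IdomainMonic.modpE _ f fM).
have modE p : in_qpoly f p = p %% f :> {poly F} by exact: rmodE.
rewrite inE; apply/existsP/idP => [[h cE]|/dvdpP[q cE]].
  have {}cE : rVpoly c = (g %% f * h) %% f.
    have := congr1 (fun p : {poly %/ f} => p : {poly F}) (eqP cE).
    rewrite poly_of_qpolyM !modE rmodE.
    by rewrite modp_small // szf ltnS size_poly.
  rewrite cE.
  have hd : g %| g %% f * h.
    apply: dvdp_mulr; rewrite -(dvdp_addr _ (_ : g %| g %/ f * f)) ?dvdp_mull //.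
    by rewrite -divp_eq dvdpp.
  rewrite -(dvdp_addr _ (_ : g %| (g %% f * h) %/ f * f)) ?dvdp_mull //.
  by rewrite -divp_eq.
by exists (in_qpoly f q); rewrite cE mulrC in_qpolyM.
Qed.

End LinearCodes.

(* Main.v *)
Require Import Defs.
From HB Require Import structures.
From mathcomp Require Import all_boot all_order all_algebra.
From mathcomp Require Import zify ring.

Set Implicit Arguments.
Unset Strict Implicit.
Unset Printing Implicit Defensive.

Import GRing.Theory.
Local Open Scope ring_scope.

(** Put f = x^n - a x^i - b and Lambda(p) = p_(i-1) + b p_(n+i-1). On polynomials
    of degree at most 2n - 2, Lambda vanishes on the multiples of f, so
    (c, d) |-> Lambda(c d) is the bilinear form on F[x]/<f> attached to the
    linear functional "coefficient of x^(i-1)". Its Gram matrix M in the basis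
    1, x, ..., x^(n-1) is monomial, hence the form is nondegenerate, and so the
    orthogonal of the ideal <g> for it is the annihilator of <g>, which is <g>
    itself because f = g^2. As Lambda(c d) is the Euclidean product of c M and
    d, this says that the dual code is C M. *)

(** If [w *m M] is zero, look at the column [j] of the only non-zero entry of row [k]: nothing else
    in that column is non-zero, so the equation there reads [w 0 k * M k j = 0]. *)
Lemma monomial_mx_unit (F : finFieldType) n (M : 'M[F]_n) :
  monomial_mx M -> M \in unitmx.
Proof.
case/andP=> /forallP rowM /forallP colM.
rewrite -row_free_unit -kermx_eq0; apply/rowV0P => w /sub_kermxP wM0.
apply/rowP=> k; rewrite mxE.
have /cards1P[j jE] := rowM k; have /cards1P[k' kE] := colM j.
have Mkj : M k j != 0 by have := set11 j; rewrite -jE inE.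
have k'E : k = k' by apply/set1P; rewrite -kE inE.
have /rowP/(_ j) := wM0; rewrite !mxE (bigD1 k) //= big1 ?addr0.
  by move/eqP; rewrite mulf_eq0 (negPf Mkj) orbF => /eqP.
move=> l lk; apply/eqP; rewrite mulf_eq0 orbC; apply/orP; left.
by apply: contraNT lk => Mlj; rewrite k'E -in_set1 -kE inE.
Qed.

Section TrinomialForm.

Variables (F : finFieldType) (n i : nat) (a b : F).
Hypotheses (i_gt0 : (0 < i)%N) (ltin : (i < n)%N).

Local Notation f := ('X^n - a *: 'X^i - b%:P).

Definition trinomial_fun (p : {poly F}) : F := p`_i.-1 + b * p`_(n + i.-1).

Definition trinomial_mx : 'M[F]_n :=
  \matrix_(j, k) ((j + k == i.-1)%N%:R + b * (j + k == n + i.-1)%N%:R).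

Lemma trinomial_funB : {morph trinomial_fun : p q / p - q}.
Proof. by move=> p q; rewrite /trinomial_fun !coefB; ring. Qed.

Lemma size_trinomial : size f = n.+1.
Proof.
rewrite -addrA size_polyDl size_polyXn // ltnS.
rewrite (leq_trans (size_polyD _ _)) // geq_max !size_polyN.
rewrite (leq_trans (size_scale_leq _ _)) ?size_polyXn //.
by rewrite (leq_trans (size_polyC_leq1 _)) //; lia.
Qed.

Lemma trinomial_monic : f \is monic.
Proof.
rewrite monicE lead_coefE size_trinomial /= !coefB coefXn eqxx coefZ coefXn coefC.
by rewrite !gtn_eqF ?mulr0 ?subr0 //; lia.
Qed.

(** For p = q f, the coefficient at i-1 is -b q_(i-1), and the one at n+i-1 is q_(i-1) - a q_(n-1) -
    b q_(n+i-1). The size bound makes deg q at most n-2, which kills the last two terms; what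
    remains cancels. *)
Lemma trinomial_fun_dvdp (p : {poly F}) :
  (size p < n.*2)%N -> f %| p -> trinomial_fun p = 0.
Proof.
move=> szp /dvdpP[q pE].
have szq : (size q <= n.-1)%N.
  have [->|q0] := eqVneq q 0; first by rewrite size_poly0.
  move: szp; rewrite pE size_Mmonic ?trinomial_monic ?size_trinomial //.
  by rewrite addnS /= -addnn ltn_add2r => ltqn; rewrite -ltnS prednK //; lia.
rewrite /trinomial_fun pE !mulrBr -scalerAr !coefB !coefZ !coefMXn !coefMC.
have -> : (i.-1 < n)%N by lia.
have -> : (i.-1 < i)%N by lia.
have -> : (n + i.-1 < n)%N = false by lia.
have -> : (n + i.-1 < i)%N = false by lia.
rewrite addKn [q`_(n + i.-1 - i)]nth_default; last by apply: leq_trans szq _; lia.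
by rewrite [q`_(n + i.-1)]nth_default; [ring | apply: leq_trans szq _; lia].
Qed.

Lemma coef_mul_rVpoly (c d : 'rV[F]_n) t :
  (rVpoly c * rVpoly d)`_t =
  \sum_(k < n) \sum_(j < n) c 0 k * d 0 j * (k + j == t)%N%:R.
Proof.
rewrite [rVpoly c]poly_def [rVpoly d]poly_def big_distrl coef_sum /=.
apply: eq_bigr => k _; rewrite big_distrr coef_sum /=; apply: eq_bigr => j _.
rewrite !valK -scalerAl -scalerAr scalerA -exprD coefZ coefXn eq_sym.
by [].
Qed.

Lemma trinomial_mxE (c d : 'rV[F]_n) :
  \sum_(j < n) d 0 j * (c *m trinomial_mx) 0 j =
  trinomial_fun (rVpoly c * rVpoly d).
Proof.
rewrite /trinomial_fun !coef_mul_rVpoly big_distrr -big_split /=.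
transitivity (\sum_(j < n) \sum_(k < n) d 0 j * (c 0 k * trinomial_mx k j)).
  by apply: eq_bigr => j _; rewrite mxE big_distrr.
rewrite exchange_big; apply: eq_bigr => k _.
rewrite big_distrr -big_split; apply: eq_bigr => j _ /=.
by rewrite mxE; ring.
Qed.

Lemma trinomial_mx_monomial : b != 0 -> monomial_mx trinomial_mx.
Proof.
move=> b0.
have rowP1 (j : 'I_n) : #|[set k | trinomial_mx j k != 0]| == 1%N.
  (* The two antidiagonals i-1 and n+i-1 differ by n, so each row meets exactly one of them. *)
  have sP : ((if j <= i.-1 then i.-1 - j else n + i.-1 - j) < n)%N.
    by case: ifP (ltn_ord j); lia.
  apply/cards1P; exists (Ordinal sP); apply/setP=> k; rewrite !inE mxE.
  rewrite -val_eqE /=; have := ltn_ord j; have := ltn_ord k.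
  case: (eqVneq (j + k)%N i.-1) => [e1|e1];
    case: (eqVneq (j + k)%N (n + i.-1)%N) => [e2|e2] kn jn; first by lia.
  - by rewrite mulr0 addr0 oner_eq0; case: ifP; lia.
  - by rewrite mulr1 add0r b0; case: ifP; lia.
  - by rewrite mulr0 addr0 eqxx; case: ifP; lia.
apply/andP; split; apply/forallP=> j //.
(* The matrix is symmetric, so columns reduce to rows. *)
rewrite -(eqP (rowP1 j)); apply/eqP/eq_card=> k.
by rewrite !inE !mxE addnC.
Qed.

End TrinomialForm.

Theorem theorem4p4 (F : finFieldType) (n i : nat) (a b : F) (g : {poly F})
    (hi : (0 < i)%N) (hin : (i < n)%N) (ha : a != 0) (hb : b != 0)
    (hgm : g \is monic) (hg : g ^+ 2 = 'X^n - a *: 'X^i - b%:P) :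
  isodual (polycyclic_code n ('X^n - a *: 'X^i - b%:P) g).
Proof.
set f := _ - _; set M := trinomial_mx n i b.
have szf : size f = n.+1 by exact: size_trinomial.
have fM : f \is monic by exact: trinomial_monic.
have f0 : f != 0 by exact: monic_neq0.
have gf : g %| f by rewrite /f -hg expr2 dvdp_mulr.
have memC c : (c \in polycyclic_code n f g) = (g %| rVpoly c).
  by apply: mem_polycyclic_code => //; lia.
have Mmon : monomial_mx M by exact: trinomial_mx_monomial.
have Munit := monomial_mx_unit Mmon.
have sizeM (c d : 'rV[F]_n) : (size (rVpoly c * rVpoly d)%R < n.*2)%N.
  have szc : (size (rVpoly c) <= n)%N by exact: size_poly.
  have szd : (size (rVpoly d) <= n)%N by exact: size_poly.
  apply: leq_ltn_trans (size_polyMleq _ _) _.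
  by have := leq_add szc szd; rewrite addnn; lia.
exists M => //; apply/setP=> v; apply/idP/imsetP => [|[c cC ->]]; last first.
  (* C M lies in the dual: g divides both c and d, so f = g^2 divides c d. *)
  rewrite inE; apply/forall_inP => d dC; apply/eqP.
  rewrite trinomial_mxE; apply: (@trinomial_fun_dvdp F n i a b) => //.
  by rewrite -hg expr2 dvdp_mul // -memC.
rewrite inE => /forall_inP vC; exists (v *m invmx M); last by rewrite mulmxKV.
set c := v *m invmx M; have vE : v = c *m M by rewrite mulmxKV.
rewrite memC.
have szmod (p : {poly F}) : (size (p %% f)%R <= n)%N by rewrite -ltnS -szf ltn_modp.
(* If c g vanishes modulo f = g^2, cancelling g gives g | c. *)
set w : 'rV[F]_n := poly_rV ((rVpoly c * g) %% f).
have wE : rVpoly w = (rVpoly c * g) %% f by rewrite poly_rV_K.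
suff w0 : w = 0.
  have : f %| rVpoly c * g by rewrite /dvdp -wE w0 linear0.
  by rewrite /f -hg expr2 dvdp_mul2r ?monic_neq0.
apply: (can_inj (mulmxK Munit)); rewrite mul0mx; apply/rowP=> l; rewrite [RHS]mxE.
(* Coordinate l of [w *m M] is Lambda(w x^l). Modulo f, both w x^l and c d equal c g x^l, and
   Lambda(c d) is the product of v with the codeword d, hence 0. Reducing w and d modulo f keeps
   both products within the degree bound. *)
set d : 'rV[F]_n := poly_rV ((g * 'X^l) %% f).
have dE : rVpoly d = (g * 'X^l) %% f by rewrite poly_rV_K.
have dC : d \in polycyclic_code n f g.
  by rewrite memC dE -(dvdp_mod _ gf) dvdp_mulr.
pose e : 'rV[F]_n := delta_mx 0 l.
have eE : rVpoly e = 'X^l by rewrite rVpoly_delta.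
have -> : (w *m M) 0 l = \sum_(j < n) e 0 j * (w *m M) 0 j.
  rewrite (bigD1 l) //= big1 => [|j jl]; first by rewrite [e 0 l]mxE !eqxx mul1r addr0.
  by rewrite [e 0 j]mxE (negPf jl) andbF mul0r.
rewrite trinomial_mxE -[LHS]subr0 -[X in _ - X](eqP (vC d dC)) vE trinomial_mxE.
rewrite -trinomial_funB; apply: (@trinomial_fun_dvdp F n i a b) => //.
  by rewrite (leq_ltn_trans (size_polyD _ _)) // gtn_max size_polyN !sizeM.
rewrite wE dE eE -/f /dvdp modpD modpN.
by rewrite [_ %% f * 'X^l]mulrC !modp_mul mulrCA [_ * g]mulrC subrr.
Qed.
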